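(* Let $K$ be a field and let $\sigma$ be an automorphism of $K$ of finite order such that $K(t;\sigma)$ is not a field. Then the multiplicative group $K(t;\sigma)^*$ contains a free non-cyclic subgroup.
   Context: $K(t;\sigma)$ denotes the quotient division ring of the skew polynomial ring $K[t;\sigma]$, which is the left $K$-module $K[t]$ with multiplication determined by $ta=\sigma(a)t$ for $a\in K$. For a division ring $D$, $D^*=D\setminus\{0\}$ is its multiplicative group. *)

(* Defs.v *)
From HB Require Import structures.
From mathcomp Require Import all_boot all_order all_algebra.

Set Implicit Arguments.
Unset Strict Implicit.
Unset Printing Implicit Defensive.

Import GRing.Theory.
Local Open Scope ring_scope.

(* The left R-module R[t] of polynomials, with coefficients written on the    *)
(* left of the powers of t; it is an alias of {poly R} because it carries the *)
(* twisted product below instead of the usual one.                            *)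
Definition skewpoly (R : nzRingType) (sigma : {rmorphism R -> R}) : Type :=
  {poly R}.

Section SkewPoly.
Variables (R : nzRingType) (sigma : {rmorphism R -> R}).

HB.instance Definition _ := GRing.Lmodule.on (skewpoly sigma).

Definition skewpoly_one : skewpoly sigma := 1%:P.

Definition skewpolyC (a : R) : skewpoly sigma := a%:P.

Definition skewpolyX : skewpoly sigma := ('X : {poly R}).

(* (a t^i) (b t^j) = (a sigma^i(b)) t^(i + j), extended biadditively.         *)
Definition skewpoly_mul (p q : skewpoly sigma) : skewpoly sigma :=
  \sum_(i < size (p : {poly R})) \sum_(j < size (q : {poly R}))
     (p`_i * iter i sigma q`_j) *: ('X^(i + j) : {poly R}).

(* Left multiplication by t. *)
Let S (q : {poly R}) : {poly R} := map_poly sigma q * 'X.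

Let S_additive : {morph S : p q / p + q}.
Proof. by move=> p q; rewrite /S rmorphD mulrDl. Qed.

Let SZ a p : S (a *: p) = sigma a *: S p.
Proof. by rewrite /S map_polyZ scalerAl. Qed.

Let SE n a k : iter n S (a *: 'X^k) = iter n sigma a *: 'X^(n + k).
Proof.
elim: n => //= n ->.
by rewrite SZ /S map_polyXn -exprSr.
Qed.

Let S0 : S 0 = 0. Proof. by rewrite /S rmorph0 mul0r. Qed.

Let S_sum n I (r : seq I) (F : I -> {poly R}) :
  iter n S (\sum_(i <- r) F i) = \sum_(i <- r) iter n S (F i).
Proof.
elim: n => //= n ->; elim: r => [|x r IH]; first by rewrite !big_nil S0.
by rewrite !big_cons S_additive IH.
Qed.

Let iterSD n : {morph iter n S : p q / p + q}.
Proof. by elim: n => [|n IH] p q; rewrite ?iterS ?IH ?S_additive. Qed.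

Let L n (p q : {poly R}) := \sum_(i < n) p`_i *: iter i S q.

Let mulE (p q : {poly R}) n : (size p <= n)%N ->
  skewpoly_mul p q = L n p q.
Proof.
move=> le_pn; rewrite /skewpoly_mul /L.
rewrite (big_ord_widen n (fun i => \sum_(j < size q)
   (p`_i * iter i sigma q`_j) *: ('X^(i + j) : {poly R}))) //.
rewrite [LHS]big_mkcond /=; apply: eq_bigr => i _; case: ltnP => [_|le_pi].
  rewrite -[q in RHS]coefK poly_def S_sum scaler_sumr.
  by apply: eq_bigr => j _; rewrite SE scalerA.
by rewrite nth_default // scale0r.
Qed.

Let mulDl : left_distributive skewpoly_mul +%R.
Proof.
move=> p q r; set n := maxn (size (p : {poly R})) (size (q : {poly R})).
rewrite (@mulE p r n) ?leq_maxl // (@mulE q r n) ?leq_maxr //.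
rewrite (@mulE _ r n) ?size_polyD // /L -big_split /=.
by apply: eq_bigr => i _; rewrite coefD scalerDl.
Qed.

Let mulDr : right_distributive skewpoly_mul +%R.
Proof.
move=> p q r; rewrite !(@mulE p _ _ (leqnn _)) /L -big_split /=.
by apply: eq_bigr => i _; rewrite iterSD scalerDr.
Qed.

Let mul0 q : skewpoly_mul 0 q = 0.
Proof. by rewrite (@mulE 0 q 0) ?size_poly0 // /L big_ord0. Qed.

Let mulZ a (p q : {poly R}) : skewpoly_mul (a *: p) q = a *: skewpoly_mul p q.
Proof.
rewrite (@mulE p q _ (leqnn _)) (@mulE (a *: p) q (size p)) ?size_scale_leq //.
by rewrite /L scaler_sumr; apply: eq_bigr => i _; rewrite coefZ scalerA.
Qed.

Let mulS (p q : {poly R}) : skewpoly_mul (S p) q = S (skewpoly_mul p q).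
Proof.
rewrite (@mulE p q _ (leqnn _)) (@mulE (S p) q (size p).+1); last first.
  rewrite (leq_trans (size_polyMleq _ _)) // size_polyX addn2 /= ltnS.
  exact: size_poly.
rewrite /L big_ord_recl /= {1}/S coefMX /= scale0r add0r.
rewrite -[RHS]/(iter 1 S _) S_sum.
by apply: eq_bigr => i _; rewrite /S coefMX /= coef_map -!/(S _) SZ.
Qed.

Let mul_iterS n (p q : {poly R}) :
  skewpoly_mul (iter n S p) q = iter n S (skewpoly_mul p q).
Proof. by elim: n => //= n IH; rewrite mulS IH. Qed.

Let mulA : associative skewpoly_mul.
Proof.
move=> p q r.
rewrite (@mulE p q _ (leqnn _)) (@mulE p _ _ (leqnn _)) /L.
elim/big_rec2: _ => [|i x y _ IH]; first by rewrite mul0.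
by rewrite mulDl -IH mulZ mul_iterS.
Qed.

Let mul1 : left_id skewpoly_one skewpoly_mul.
Proof.
move=> p; rewrite (@mulE _ p 1) ?size_poly1 // /L big_ord1 /=.
by rewrite coefC eqxx scale1r.
Qed.

Let mulr1 : right_id skewpoly_one skewpoly_mul.
Proof.
move=> p; rewrite (@mulE p _ _ (leqnn _)) /L -[RHS]coefK poly_def.
apply: eq_bigr => i _; congr (_ *: _).
have -> : skewpoly_one = 1 *: 'X^0 :> {poly R} by rewrite scale1r expr0.
rewrite SE addn0; suff -> : iter i sigma 1 = 1 by rewrite scale1r.
by elim: (i : nat) => //= k ->; rewrite rmorph1.
Qed.

Let one_neq0 : skewpoly_one != 0.
Proof. exact: oner_neq0. Qed.

HB.instance Definition _ := GRing.Zmodule_isNzRing.Build (skewpoly sigma)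
  mulA mul1 mulr1 mulDl mulDr one_neq0.

Lemma skewpolyXC (a : R) :
  skewpolyX * skewpolyC a = skewpolyC (sigma a) * skewpolyX.
Proof.
have -> : skewpolyX = S 1 by rewrite /S rmorph1 mul1r.
transitivity (sigma a *: S 1 : {poly R}).
  rewrite [LHS]mulS [skewpoly_mul _ _]mul1 /skewpolyC -[a%:P]alg_polyC.
  exact: SZ.
rewrite -[sigma a *: _]/(sigma a *: (S 1 : skewpoly sigma)).
rewrite -[S 1 in LHS](@mul1 (S 1)) -mulZ.
by rewrite /skewpolyC -alg_polyC.
Qed.

End SkewPoly.

HB.mixin Record UnitRing_isDivRing D of GRing.UnitRing D := {
  divring_unitP : GRing.field_axiom D
}.

#[short(type="divRingType")]
HB.structure Definition DivRing :=
  {D of GRing.UnitRing D & UnitRing_isDivRing D}.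

(* D is a quotient division ring of R along iota. Fractions are written with  *)
(* the denominator on the left; when R is also right Ore, as K[t; sigma] is   *)
(* for sigma an automorphism of a field K, each such fraction is also of the  *)
(* form iota p / iota q.                                                      *)
Definition quotient_division_ring (R : nzRingType) (D : divRingType)
    (iota : {rmorphism R -> D}) : Prop :=
  injective iota /\
  forall x : D, exists p q : R, q != 0 /\ x = (iota q)^-1 * iota p.

Definition finite_order (T : Type) (f : T -> T) : Prop :=
  exists2 n, (0 < n)%N & iter n f =1 id.

Section MultiplicativeGroup.
Variable D : divRingType.

Definition mulgrp : Type := {x : D | x != 0}.

HB.instance Definition _ := [isSub of mulgrp for @sval D _].
HB.instance Definition _ := [Choice of mulgrp by <:].

Let unitE (x : D) : (x \is a GRing.unit) = (x != 0).
Proof.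
apply/idP/idP => [Ux|]; last exact: divring_unitP.
by apply: contraTneq Ux => ->; rewrite unitr0.
Qed.

Let mul_neq0 (x y : mulgrp) : sval x * sval y != 0.
Proof. by rewrite -unitE unitrMl ?unitE ?(valP x) ?(valP y). Qed.

Let inv_neq0 (x : mulgrp) : (sval x)^-1 != 0.
Proof. by rewrite -unitE unitrV unitE (valP x). Qed.

Definition mulgrp_one : mulgrp := Sub 1 (oner_neq0 D).
Definition mulgrp_mul (x y : mulgrp) : mulgrp := Sub (sval x * sval y) (mul_neq0 x y).
Definition mulgrp_inv (x : mulgrp) : mulgrp := Sub (sval x)^-1 (inv_neq0 x).

Let mulgA : associative mulgrp_mul.
Proof. by move=> x y z; apply: val_inj; rewrite /= mulrA. Qed.

Let mul1g : left_id mulgrp_one mulgrp_mul.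
Proof. by move=> x; apply: val_inj; rewrite /= mul1r. Qed.

Let mulg1 : right_id mulgrp_one mulgrp_mul.
Proof. by move=> x; apply: val_inj; rewrite /= mulr1. Qed.

Let mulVg : left_inverse mulgrp_one mulgrp_inv mulgrp_mul.
Proof. by move=> x; apply: val_inj; rewrite /= mulVr // unitE (valP x). Qed.

Let mulgV : right_inverse mulgrp_one mulgrp_inv mulgrp_mul.
Proof. by move=> x; apply: val_inj; rewrite /= divrr // unitE (valP x). Qed.

HB.instance Definition _ := isGroup.Build mulgrp
  mulgA mul1g mulg1 mulVg mulgV.

End MultiplicativeGroup.

Section FreeSubgroups.
Variable G : groupType.
Implicit Types (H X : G -> Prop) (w : seq (G * bool)).
Local Open Scope group_scope.

Definition subgroup H : Prop :=
  H 1 /\ forall x y, H x -> H y -> H (x / y).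

(* The library has no integer powers in a possibly infinite group. *)
Definition cyclic_subgroup H : Prop :=
  exists g : G, forall h, H h <-> exists n : nat, h = g ^+ n \/ h = g ^- n.

(* In a word, the letter (x, b) stands for x if b = false, and for the formal *)
(* inverse of x if b = true.                                                  *)
Definition word_over X w : Prop := forall l, l \in w -> X l.1.

Definition reduced w : bool :=
  sorted (fun l m : G * bool => ~~ ((l.1 == m.1) && (l.2 != m.2))) w.

Definition word_val w : G := \prod_(l <- w) (if l.2 then l.1^-1 else l.1).

Definition free_basis X H : Prop :=
  (forall h, H h <-> exists2 w, word_over X w & word_val w = h) /\
  (forall w, word_over X w -> reduced w -> word_val w = 1 -> w = [::]).

Definition free_subgroup H : Prop := exists X, free_basis X H.

End FreeSubgroups.

(* Main.v *)
Require Import Defs.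
From HB Require Import structures.
From mathcomp Require Import all_boot all_order all_algebra.
From mathcomp Require Import ring.
From Stdlib Require Import Classical.
Set Implicit Arguments.
Unset Strict Implicit.
Unset Printing Implicit Defensive.
Import GRing.Theory.
Local Open Scope ring_scope.

(* Take a in K with sigma a != a and n > 1 with sigma^n = 1, so that z = t^n  *)
(* is central, and reduce at the place z = a. For this let K[t; sigma] act on *)
(* sequences by (r h)(i) = sum_k sigma^i(r_k) h(i + k), and follow the action *)
(* on the plane spanned by a sequence e0 with z e0 = a e0 and by e1 = t e0.   *)
(* The element g = (z - sigma a) / (z - a) and its inverse have poles there,  *)
(* whose leading coefficients are multiples of the two coordinate projections *)
(* of the plane. Conjugating g by some c that is regular at the place, and    *)
(* whose reduction and inverse have no zero entry, gives h. The leading       *)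
(* coefficients of g, g^-1, h and h^-1 are of rank one, and the product of    *)
(* two of them vanishes only for mutually inverse letters. So a reduced word  *)
(* of length m > 0 in g and h has a pole of order m, and is not 1.            *)

(** Call an element of [D] regular at the place z = a when it is a fraction that acts on the plane
    through a matrix, its reduction; this is [represents], and [acts_by_inj] makes the matrix of an
    element of K[t; sigma] unique. A central element [p] that acts on the plane by 0 serves as local
    parameter. By [hyperbolic_element], p g and p g^-1 reduce to multiples of the two coordinate
    projections, and [transverse_element] gives the conjugator c. A word of length m in g and h,
    times p^m, reduces to a product of rank-one matrices, nonzero by [rank_one_prod]. Were the word
    1, this product would be the reduction of p^m, which is 0 for m > 0. Hence [free_pair], and
    [free_pair_noncyclic_subgroup] passes to subgroups. The required a exists because sigma = id
    would make [D] commutative. *)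

Section SkewPolyTheory.
Variables (K : fieldType) (sigma : {rmorphism K -> K}).
Local Notation R := (skewpoly sigma).
Local Notation C := (@skewpolyC K sigma).
Local Notation t := (@skewpolyX K sigma).
Implicit Types (p q r : R) (h : nat -> K).

(** * Skew polynomials and their action on sequences *)

Lemma iter_rmorphD i : {morph iter i sigma : x y / x + y}.
Proof. by elim: i => //= i IH x y; rewrite !iterS IH rmorphD. Qed.

Lemma iter_rmorphM i : {morph iter i sigma : x y / x * y}.
Proof. by elim: i => //= i IH x y; rewrite !iterS IH rmorphM. Qed.

Lemma iter_rmorph0 i : iter i sigma 0 = 0.
Proof. by elim: i => //= i ->; rewrite rmorph0. Qed.

Lemma iter_rmorph1 i : iter i sigma 1 = 1.
Proof. by elim: i => //= i ->; rewrite rmorph1. Qed.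

Lemma skewpoly_mulE p q m n : (size (p : {poly K}) <= m)%N ->
    (size (q : {poly K}) <= n)%N ->
  p * q = \sum_(i < m) \sum_(j < n)
            (p`_i * iter i sigma q`_j) *: ('X^(i + j) : {poly K}).
Proof.
move=> le_pm le_qn.
rewrite -[LHS]/(\sum_(i < size (p : {poly K})) \sum_(j < size (q : {poly K}))
     (p`_i * iter i sigma q`_j) *: ('X^(i + j) : {poly K})).
rewrite (big_ord_widen m (fun i => \sum_(j < size (q : {poly K}))
   (p`_i * iter i sigma q`_j) *: ('X^(i + j) : {poly K}))) //.
rewrite big_mkcond /=; apply: eq_bigr => i _; case: ltnP => [_|le_pi].
  rewrite (big_ord_widen n (fun j =>
     (p`_i * iter i sigma q`_j) *: ('X^(i + j) : {poly K}))) //.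
  rewrite big_mkcond /=; apply: eq_bigr => j _; case: ltnP => // le_qj.
  by rewrite (nth_default _ le_qj) iter_rmorph0 mulr0 scale0r.
by rewrite big1 // => j _; rewrite (nth_default _ le_pi) mul0r scale0r.
Qed.

Lemma skewpolyC_mul a q : C a * q = a *: (q : {poly K}).
Proof.
rewrite (@skewpoly_mulE _ _ 1 _ (size_polyC_leq1 a) (leqnn _)) big_ord1.
rewrite -[q in RHS]coefK poly_def scaler_sumr.
by apply: eq_bigr => j _; rewrite coefC eqxx add0n scalerA.
Qed.

Lemma skewpolyX_exp k : t ^+ k = ('X^k : {poly K}).
Proof.
elim: k => [|k IH]; first by [].
rewrite exprS IH (@skewpoly_mulE _ _ 2 k.+1) ?size_polyX ?size_polyXn //.
rewrite big_ord_recl big_ord1 /= big1 ?add0r => [|j _]; last first.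
  by rewrite coefX mul0r scale0r.
rewrite big_ord_recr /= big1 ?add0r => [|j _]; last first.
  by rewrite coefXn /= ltn_eqF // rmorph0 mulr0 scale0r.
by rewrite coefX coefXn !eqxx !rmorph1 mulr1 scale1r.
Qed.

Lemma skewpoly_def p : p = \sum_(i < size (p : {poly K})) C p`_i * t ^+ i.
Proof.
rewrite -[LHS]coefK poly_def; apply: eq_bigr => i _.
by rewrite skewpolyX_exp skewpolyC_mul.
Qed.

Lemma skewpolyC_is_zmod_morphism : zmod_morphism C.
Proof. by move=> a b; exact: polyCB. Qed.

Lemma skewpolyC_is_monoid_morphism : monoid_morphism C.
Proof.
split=> // a b; rewrite skewpolyC_mul /skewpolyC -mul_polyC.
exact: polyCM.
Qed.

HB.instance Definition _ :=
  GRing.isZmodMorphism.Build K R C skewpolyC_is_zmod_morphism.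
HB.instance Definition _ :=
  GRing.isMonoidMorphism.Build K R C skewpolyC_is_monoid_morphism.

Lemma skewpolyXnC k a : t ^+ k * C a = C (iter k sigma a) * t ^+ k.
Proof.
elim: k a => [|k IH] a; first by rewrite mul1r mulr1.
by rewrite exprSr -mulrA skewpolyXC mulrA IH -iterSr -mulrA -exprSr.
Qed.

Lemma skewpolyX_neq0 : t != 0.
Proof. by rewrite -size_poly_eq0 size_polyX. Qed.

Lemma skewpoly_centralP s :
  GRing.comm s t -> (forall a, GRing.comm s (C a)) -> forall p, GRing.comm s p.
Proof.
move=> st sC p; rewrite (skewpoly_def p).
by apply: commr_sum => i _; apply: commrM => //; apply: commrX.
Qed.

(** Here t is the shift and a constant c multiplies the i-th term by sigma^i(c), which reproduces
    the rule t c = sigma(c) t. *)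
Definition act r h i : K :=
  \sum_(k < size (r : {poly K})) iter i sigma r`_k * h (i + k)%N.

Lemma act_widen r h i m : (size (r : {poly K}) <= m)%N ->
  act r h i = \sum_(k < m) iter i sigma r`_k * h (i + k)%N.
Proof.
move=> le_rm; rewrite /act.
rewrite (big_ord_widen m (fun k => iter i sigma r`_k * h (i + k)%N)) //.
rewrite big_mkcond /=; apply: eq_bigr => k _; case: ltnP => // le_rk.
by rewrite (nth_default _ le_rk) iter_rmorph0 mul0r.
Qed.

Lemma eq_act r h h' : h =1 h' -> act r h =1 act r h'.
Proof. by move=> eqh i; apply: eq_bigr => k _; rewrite eqh. Qed.

Lemma act0 h i : act 0 h i = 0.
Proof. by rewrite (@act_widen _ _ _ 0) ?size_poly0 // big_ord0. Qed.

Lemma actD p q h i : act (p + q) h i = act p h i + act q h i.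
Proof.
set m := maxn (size (p : {poly K})) (size (q : {poly K})).
rewrite !(@act_widen _ _ _ m) ?leq_maxl ?leq_maxr ?size_polyD // -big_split /=.
by apply: eq_bigr => k _; rewrite coefD iter_rmorphD mulrDl.
Qed.

Lemma actN p h i : act (- p) h i = - act p h i.
Proof. by apply/eqP; rewrite -addr_eq0 -actD addNr act0. Qed.

Lemma act_sum I (s : seq I) (F : I -> R) h i :
  act (\sum_(j <- s) F j) h i = \sum_(j <- s) act (F j) h i.
Proof.
by apply: (big_morph (fun p => act p h i)) => [p q|]; rewrite ?actD ?act0.
Qed.

Lemma act_monomial a k h i :
  act (a *: ('X^k : {poly K})) h i = iter i sigma a * h (i + k)%N.
Proof.
rewrite (@act_widen _ _ _ k.+1); last first.
  by rewrite (leq_trans (size_scale_leq _ _)) // size_polyXn.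
rewrite big_ord_recr /= big1 ?add0r => [|j _]; last first.
  by rewrite coefZ coefXn ltn_eqF // mulr0 iter_rmorph0 mul0r.
by rewrite coefZ coefXn eqxx mulr1.
Qed.

Lemma actM p q h : act (p * q) h =1 act p (act q h).
Proof.
move=> i; rewrite (skewpoly_mulE (leqnn _) (leqnn _)) act_sum.
apply: eq_bigr => k _; rewrite act_sum mulr_sumr; apply: eq_bigr => l _.
by rewrite act_monomial iter_rmorphM -iterD mulrA addnA.
Qed.

Lemma actC a h i : act (C a) h i = iter i sigma a * h i.
Proof.
rewrite -[C a]mulr1 skewpolyC_mul -[(1 : R)]/('X^0 : {poly K}).
by rewrite act_monomial addn0.
Qed.

Lemma actXn k h i : act (t ^+ k) h i = h (i + k)%N.
Proof.
rewrite skewpolyX_exp -[('X^k : {poly K})]scale1r act_monomial.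
by rewrite iter_rmorph1 mul1r.
Qed.

End SkewPolyTheory.

(** * Two-by-two matrices given by their entries *)

Section Matrix2.
Variable F : comNzRingType.

Definition mx2 (a b c d : F) : 'M[F]_2 :=
  \matrix_(i, j) if i == 0 then if j == 0 then a else b
                 else if j == 0 then c else d.

Lemma mx2_mul a b c d a' b' c' d' :
  mx2 a b c d * mx2 a' b' c' d' =
  mx2 (a * a' + b * c') (a * b' + b * d') (c * a' + d * c') (c * b' + d * d').
Proof.
apply/matrixP=> i j; rewrite !mxE big_ord_recl big_ord1 !mxE.
by case: i => [[|[|?]] ?] //=; case: j => [[|[|?]] ?].
Qed.

Lemma mx2D a b c d a' b' c' d' :
  mx2 a b c d + mx2 a' b' c' d' = mx2 (a + a') (b + b') (c + c') (d + d').
Proof. by apply/matrixP=> i j; rewrite !mxE; do 2!case: ifP. Qed.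

Lemma mx2N a b c d : - mx2 a b c d = mx2 (- a) (- b) (- c) (- d).
Proof. by apply/matrixP=> i j; rewrite !mxE; do 2!case: ifP. Qed.

Lemma mx2_scalar a : a%:M = mx2 a 0 0 a.
Proof.
by apply/matrixP=> i j; rewrite !mxE; case: i => [[|[|?]] ?] //=;
  case: j => [[|[|?]] ?].
Qed.

Lemma mx2_1 : 1 = mx2 1 0 0 1.
Proof. exact: mx2_scalar. Qed.

Lemma mx2_0 : 0 = mx2 0 0 0 0.
Proof. by rewrite -mx2_scalar raddf0. Qed.

Lemma mx2_eq0 a b c d :
  (mx2 a b c d == 0) = [&& a == 0, b == 0, c == 0 & d == 0].
Proof.
apply/eqP/and4P=> [/matrixP M0|[/eqP-> /eqP-> /eqP-> /eqP->]]; last first.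
  by rewrite -mx2_0.
by split; apply/eqP;
  [move: (M0 0 0)|move: (M0 0 1)|move: (M0 1 0)|move: (M0 1 1)]; rewrite !mxE.
Qed.

Lemma mx2_mulv0 a b c d (v : 'cV_2) :
  (mx2 a b c d *m v) 0 0 = a * v 0 0 + b * v 1 0.
Proof.
rewrite mxE big_ord_recl big_ord1 !mxE /=.
by congr (_ + _ * v _ _); apply: val_inj.
Qed.

Lemma mx2_mulv1 a b c d (v : 'cV_2) :
  (mx2 a b c d *m v) 1 0 = c * v 0 0 + d * v 1 0.
Proof.
rewrite mxE big_ord_recl big_ord1 !mxE /=.
by congr (_ + _ * v _ _); apply: val_inj.
Qed.

End Matrix2.

(** * Nonvanishing of products of rank-one matrices *)

Section RankOneProducts.
Variables (F : fieldType) (m : nat) (I : Type) (ok : rel I).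
Variables (x : I -> 'cV[F]_m.+1) (y : I -> 'rV[F]_m.+1).
Hypothesis ok_refl : reflexive ok.
Hypothesis okP : forall i j, ok i j -> y i *m x j != 0.

(** The product telescopes to x_first y_last times the scalars y_l x_l' over consecutive letters,
    all nonzero by [okP]. *)
Lemma rank_one_prod i w : path ok i w ->
  \prod_(l <- i :: w) (x l *m y l) != 0.
Proof.
suff: path ok i w -> exists2 c, c != 0 &
    \prod_(l <- i :: w) (x l *m y l) = c *: (x i *m y (last i w)).
  move=> /[apply] -[c c0 ->]; rewrite scaler_eq0 negb_or c0 /=.
  (* If x_i y_last were 0, so would be the product of the two nonzero scalars y_i x_i and y_last
     x_last. *)
  apply: contraNneq (okP (ok_refl i)) => xy0.
  have := okP (ok_refl (last i w)); apply: contraNeq => yx.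
  have : (y i *m x i) *m (y (last i w) *m x (last i w)) = 0.
    by rewrite -mulmxA (mulmxA (x i)) xy0 mul0mx mulmx0.
  rewrite [y i *m _]mx11_scalar mul_scalar_mx => /eqP.
  rewrite scaler_eq0 => /orP[/eqP y0|/eqP //].
  by move: yx; rewrite [y i *m _]mx11_scalar y0 raddf0 eqxx.
elim: w i => [|j w IH] i /=.
  by exists 1; [exact: oner_neq0 | rewrite big_seq1 scale1r].
case/andP=> ij /IH [c c0 E]; rewrite big_cons E.
have := okP ij; rewrite [y i *m _]mx11_scalar; set k := (_ *m _) 0 0 => k0.
exists (c * k).
  by rewrite mulf_neq0 //; apply: contraNneq k0 => ->; rewrite raddf0.
rewrite -[_ * _]/((x i *m y i) *m _) -scalemxAr -mulmxA (mulmxA (y i)).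
by rewrite [y i *m _]mx11_scalar mul_scalar_mx -scalemxAr scalerA.
Qed.

End RankOneProducts.

(** * The plane spanned by [e0] and [e1], and the elements that act on it *)

Section LocalAction.
Variables (K : fieldType) (sigma : {rmorphism K -> K}) (n : nat) (a : K).
Hypotheses (n_gt1 : (1 < n)%N) (sigma_n : iter n sigma =1 id).
Local Notation R := (skewpoly sigma).
Local Notation C := (@skewpolyC K sigma).
Local Notation t := (@skewpolyX K sigma).

Lemma iter_sigma_dvd i x : (n %| i)%N -> iter i sigma x = x.
Proof.
move=> /dvdnP[k ->]; elim: k => // k IH.
by rewrite mulSn iterD IH sigma_n.
Qed.

Lemma Xn_commC : commr_rmorph C (t ^+ n).
Proof. by move=> x; rewrite /GRing.comm skewpolyXnC sigma_n. Qed.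

Lemma Xn_central p : GRing.comm (t ^+ n) p.
Proof.
apply: skewpoly_centralP => [|x]; last exact: Xn_commC.
exact/commr_sym/commrX.
Qed.

(** Evaluation at the central element z = t^n. The values commute with one another and with K, but t
    carries f(z) to (sigma f)(z). *)
Definition central_eval : {poly K} -> R := horner_morph Xn_commC.

HB.instance Definition _ := GRing.RMorphism.on central_eval.

Lemma central_evalC x : central_eval x%:P = C x.
Proof. exact: horner_morphC. Qed.

Lemma central_evalX : central_eval 'X = t ^+ n.
Proof. exact: horner_morphX. Qed.

Lemma skewpolyX_central_eval f :
  t * central_eval f = central_eval (map_poly sigma f) * t.
Proof.
elim/poly_ind: f => [|f c IH]; first by rewrite !rmorph0 mulr0 mul0r.
rewrite !rmorphD !rmorphM /= map_polyX map_polyC /= central_evalX.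
rewrite !central_evalC mulrDr mulrDl mulrA IH -!mulrA skewpolyXC.
by rewrite -exprS -exprSr.
Qed.

(** An eigenvector of z for a. Being supported on the multiples of n, where sigma^i = id, it is also
    an eigenvector of every constant. *)
Definition e0 (i : nat) : K := if (n %| i)%N then a ^+ (i %/ n) else 0.
Definition e1 (i : nat) : K := e0 i.+1.
Definition comb (v : 'cV[K]_2) i := v 0 0 * e0 i + v 1 0 * e1 i.

Lemma e0_shift i : e0 (i + n) = a * e0 i.
Proof.
rewrite /e0 dvdn_addl //; case: ifP => _; last by rewrite mulr0.
by rewrite divnDr // divnn (ltnW n_gt1) addn1 exprS.
Qed.

(** The term at 0 is v_0, as [e1] vanishes there for n > 1; once v_0 = 0, the term at n - 1 is a
    v_1. *)
Lemma comb_eq0 v : a != 0 -> comb v =1 (fun=> 0) -> v = 0.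
Proof.
move=> a0 v0; have v00 : v 0 0 = 0.
  have := v0 0; rewrite /comb /e1 /e0 dvdn0 div0n dvdn1.
  by rewrite (gtn_eqF n_gt1) mulr0 addr0 mulr1.
have v10 : v 1 0 = 0.
  have := v0 n.-1; rewrite /comb /e1 v00 mul0r add0r /e0.
  rewrite prednK ?(ltnW n_gt1) // dvdnn divnn (ltnW n_gt1) expr1 => /eqP.
  by rewrite mulf_eq0 (negPf a0) orbF => /eqP.
apply/colP=> i; rewrite mxE; case: i => [[|[|?]] ?] //.
  by rewrite -[RHS]v00; congr (v _ _); apply: val_inj.
by rewrite -[RHS]v10; congr (v _ _); apply: val_inj.
Qed.

(** A relation, since not every element preserves the plane: for n > 2 and a nonzero, t moves [e1]
    out of it. *)
Definition acts_by (r : R) (M : 'M[K]_2) : Prop :=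
  forall v, act r (comb v) =1 comb (M *m v).

Lemma acts_by0 : acts_by 0 0.
Proof.
by move=> v i; rewrite act0 mul0mx /comb !mxE !mul0r addr0.
Qed.

Lemma acts_byD r s M N : acts_by r M -> acts_by s N -> acts_by (r + s) (M + N).
Proof.
move=> rM sN v i; rewrite actD rM sN mulmxDl /comb !mxE; ring.
Qed.

Lemma acts_byN r M : acts_by r M -> acts_by (- r) (- M).
Proof. by move=> rM v i; rewrite actN rM mulNmx /comb !mxE; ring. Qed.

Lemma acts_byM r s M N : acts_by r M -> acts_by s N -> acts_by (r * s) (M * N).
Proof.
move=> rM sN v i; rewrite actM (eq_act _ (sN v)) rM.
by rewrite -[M * N]/(M *m N) mulmxA.
Qed.

Lemma acts_by1 : acts_by 1 1.
Proof.
move=> v i; rewrite -(expr0 t) actXn addn0.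
by rewrite -[1 : 'M_2]/(1%:M) mul1mx.
Qed.

Lemma acts_byX r M k : acts_by r M -> acts_by (r ^+ k) (M ^+ k).
Proof.
move=> rM; elim: k => [|k IH]; first exact: acts_by1.
by rewrite !exprS; apply: acts_byM.
Qed.

Lemma acts_by_sum k (F : 'I_k -> R) (G : 'I_k -> 'M_2) :
  (forall i, acts_by (F i) (G i)) -> acts_by (\sum_i F i) (\sum_i G i).
Proof.
move=> FG; apply: (big_ind2 acts_by) => //; first exact: acts_by0.
by move=> *; apply: acts_byD.
Qed.

Lemma acts_by_Xn : acts_by (t ^+ n) a%:M.
Proof.
move=> v i; rewrite actXn mul_scalar_mx /comb !mxE /e1 -addSn !e0_shift; ring.
Qed.

Lemma acts_by_inj r M N : a != 0 -> acts_by r M -> acts_by r N -> M = N.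
Proof.
move=> a0 rM rN; apply/eqP; rewrite -subr_eq0; apply/eqP.
have D0 : acts_by 0 (M - N) by rewrite -(subrr r); apply/acts_byD/acts_byN.
apply/trmx_inj/row_matrixP=> i; rewrite -tr_col colE.
rewrite trmx0 row0 -[RHS]trmx0; congr (_^T); apply: comb_eq0 => // j.
by rewrite -D0 act0.
Qed.

Lemma acts_by_neq0 r M : a != 0 -> acts_by r M -> M != 0 -> r != 0.
Proof.
by move=> a0 rM; apply: contraNneq => r0; apply/eqP; apply: (acts_by_inj a0 rM);
  rewrite r0; apply: acts_by0.
Qed.

(** On the support of [e1], i + 1 is a multiple of n, so sigma^i is the inverse of sigma; writing
    the constant as sigma c avoids naming this inverse. *)
Lemma acts_by_sigmaC c : acts_by (C (sigma c)) (mx2 (sigma c) 0 0 c).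
Proof.
move=> v i; rewrite actC /comb mx2_mulv0 mx2_mulv1 !mul0r addr0 add0r /e1 /e0.
rewrite -iterSr mulrDr; congr (_ + _).
  case: ifP => [ni|_]; last by rewrite !mulr0.
  by rewrite iterS iter_sigma_dvd // mulrA.
case: ifP => [ni|_]; last by rewrite !mulr0.
by rewrite iter_sigma_dvd // mulrA.
Qed.

Lemma acts_by_central_eval_map f :
  acts_by (central_eval (map_poly sigma f))
          (mx2 (map_poly sigma f).[a] 0 0 f.[a]).
Proof.
elim/poly_ind: f => [|f c IH].
  by rewrite !rmorph0 horner0 -mx2_0; apply: acts_by0.
rewrite !rmorphD !rmorphM /= map_polyX map_polyC /= central_evalX central_evalC.
rewrite !hornerE.
have := acts_byD (acts_byM IH acts_by_Xn) (acts_by_sigmaC c).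
by rewrite mx2_scalar mx2_mul mx2D !(mulr0, mul0r, addr0, add0r).
Qed.

(** The entry c is the value at a of sigma^-1 f, where sigma^-1 = sigma^(n-1). *)
Lemma acts_by_central_eval f :
  exists c, acts_by (central_eval f) (mx2 f.[a] 0 0 c).
Proof.
have -> : f = map_poly sigma (map_poly (iter n.-1 sigma) f).
  apply/polyP=> i; rewrite coef_map coef_map_id0 ?iter_rmorph0 //=.
  by rewrite -iterS prednK ?sigma_n // ltnW.
by eexists; apply: acts_by_central_eval_map.
Qed.

(** Since t is controlled only on [e0], which it sends to [e1], r must first kill the [e1]
    coordinate. *)
Lemma acts_by_XM r u b : acts_by r (mx2 u 0 0 b) -> b = 0 ->
  acts_by (t * r) (mx2 0 0 u 0).
Proof.
move=> rM b0 v i; rewrite actM (eq_act _ (rM v)) -[t]expr1 actXn.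
rewrite /comb !mx2_mulv0 !mx2_mulv1 b0 !mul0r !addr0 !mul0r add0r addr0.
by rewrite addn1.
Qed.

(** Dually, t^(n-1) sends [e1] to z [e0] = a [e0]. *)
Lemma acts_by_Xn1M r u b : acts_by r (mx2 b 0 0 u) -> b = 0 ->
  acts_by (t ^+ n.-1 * r) (mx2 0 (a * u) 0 0).
Proof.
move=> rM b0 v i; rewrite actM (eq_act _ (rM v)) actXn.
rewrite /comb !mx2_mulv0 !mx2_mulv1 b0 !mul0r !addr0 !mul0r !add0r addr0.
rewrite /e1 -addnS prednK ?(ltnW n_gt1) // e0_shift; ring.
Qed.

(* Q is the product of the X - sigma^j a for 1 < j < d, d the period of a.    *)
Lemma period_poly : sigma a != a -> exists Q : {poly K},
  map_poly sigma (('X - (sigma a)%:P) * Q) = ('X - a%:P) * Q /\ Q.[a] != 0.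
Proof.
move=> sa.
have ex : exists d, (0 < d)%N && (iter d sigma a == a).
  by exists n; rewrite sigma_n eqxx (ltnW n_gt1).
case: (ex_minnP ex) => d /andP[d0 /eqP da] dmin.
case: d d0 da dmin => [//|[|d]] _ da dmin; first by rewrite -{2}da eqxx in sa.
exists (\prod_(2 <= j < d.+2) ('X - (iter j sigma a)%:P)); split; last first.
  rewrite horner_prod prodf_seq_neq0; apply/allP=> j.
  rewrite mem_index_iota => /andP[j2 jd] /=.
  rewrite hornerXsubC subr_eq0; apply/eqP=> aj.
  by have := dmin j; rewrite -aj eqxx (ltnW j2) => /(_ isT); rewrite leqNgt jd.
rewrite -[X in 'X - X%:P]/(iter 1 sigma a) -big_ltn // rmorph_prod /=.
under eq_bigr => j _ do rewrite rmorphB /= map_polyX map_polyC /= -iterS.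
(* Applying sigma shifts the indices by one; the new last index is the period [d.+2], whose factor
   is X - a. *)
rewrite -(big_add1 _ _ 1 d.+3 predT (fun j => 'X - (iter j sigma a)%:P)).
by rewrite big_nat_recr //= -!iterS da mulrC.
Qed.

(** * Reduction of elements of the quotient division ring *)

Variables (D : divRingType) (iota : {rmorphism R -> D}).
Hypothesis iota_inj : injective iota.

Hypothesis D_quot : forall x : D,
  exists p q : R, q != 0 /\ x = (iota q)^-1 * iota p.

Let iota_unit r : r != 0 -> iota r \is a GRing.unit.
Proof. by move=> r0; apply: divring_unitP; rewrite -(rmorph0 iota) inj_eq. Qed.

Let divring_unitE (x : D) : (x \is a GRing.unit) = (x != 0).
Proof.
by apply/idP/idP=> [|/divring_unitP//]; apply: contraTneq => ->; rewrite unitr0.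
Qed.

Let mul_cancell (p q r : R) : p != 0 -> p * q = p * r -> q = r.
Proof.
move=> p0 /(congr1 iota); rewrite !rmorphM.
by move/(mulrI (iota_unit p0))/iota_inj.
Qed.

Let mul_cancelr (p q r : R) : p != 0 -> q * p = r * p -> q = r.
Proof.
move=> p0 /(congr1 iota); rewrite !rmorphM.
by move/(mulIr (iota_unit p0))/iota_inj.
Qed.

Let mul_neq0 (p q : R) : p != 0 -> q != 0 -> p * q != 0.
Proof.
move=> p0; apply: contraNneq => pq0.
by apply/eqP/(mul_cancell p0); rewrite mulr0.
Qed.

Let Xn_neq0 k : t ^+ k != 0.
Proof.
elim: k => [|k IH]; first exact: oner_neq0.
by rewrite exprS mul_neq0 // skewpolyX_neq0.
Qed.

(* The power W of y = f t^k clearly commutes with K and z, hence with f, and  *)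
(* with y; cancelling f, it commutes with t^k, and thus with t = t^(km) z^-l. *)
Lemma twisted_power_central f k m l :
    central_eval f != 0 -> (k * m = n * l + 1)%N ->
  forall q : R, GRing.comm ((central_eval f * t ^+ k) ^+ n) q.
Proof.
move=> f0 km; set y := _ * _; set W := y ^+ n.
have yC j x : y ^+ j * C x = C (iter (j * k) sigma x) * y ^+ j.
  elim: j x => [|j IH] x; first by rewrite mul1r mulr1.
  rewrite exprSr -mulrA /y -mulrA skewpolyXnC (mulrA (central_eval f)).
  rewrite -!central_evalC -rmorphM mulrC rmorphM /= central_evalC.
  by rewrite -!mulrA mulrA IH central_evalC -iterD mulSn addnC -!mulrA.
have WC x : GRing.comm W (C x).
  by rewrite /GRing.comm yC iter_sigma_dvd // dvdn_mulr.
have Wf g : GRing.comm W (central_eval g).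
  elim/poly_ind: g => [|g c IH]; first by rewrite rmorph0; apply: commr0.
  rewrite rmorphD rmorphM /= central_evalX central_evalC.
  by apply/commrD/WC/commrM/commr_sym/Xn_central.
have Wy : GRing.comm W y by apply/commr_sym/commrX.
have Wtk : GRing.comm W (t ^+ k).
  apply: (mul_cancell f0); rewrite [RHS]mulrA -/y -Wy /y !mulrA.
  by rewrite -(Wf f).
apply: skewpoly_centralP => //.
have := commrX m Wtk; rewrite -exprM km addn1 exprS => Wt.
apply: (mul_cancelr (Xn_neq0 (n * l))); rewrite -mulrA Wt -!mulrA.
congr (_ * _); apply/commr_sym; rewrite exprM.
exact/commrX/commr_sym/Xn_central.
Qed.

(* d is congruent to M at the place t ^ n = a: up to a central denominator    *)
(* that is invertible there, it comes from an element acting on the span of   *)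
(* e0 and e1 through M.                                                       *)
Definition represents (d : D) (M : 'M[K]_2) : Prop :=
  exists (s r : R) (k : K), [/\ k != 0, forall q, GRing.comm s q,
    acts_by s k%:M, acts_by r (k *: M) & iota s * d = iota r].

Lemma represents_iota r M : acts_by r M -> represents (iota r) M.
Proof.
move=> rM; exists 1, r, 1; split=> //; first exact: oner_neq0.
- by move=> q; apply/commr_sym/commr1.
- exact: acts_by1.
- by rewrite scale1r.
- by rewrite rmorph1 mul1r.
Qed.

Lemma representsM d d' M M' :
  represents d M -> represents d' M' -> represents (d * d') (M * M').
Proof.
move=> [s [r [k [k0 sc sk rM E]]]] [s' [r' [k' [k'0 s'c sk' rM' E']]]].
exists (s * s'), (r * r'), (k * k'); split; first by rewrite mulf_neq0.
- by move=> q; apply/commr_sym/commrM; apply/commr_sym.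
- by rewrite scalar_mxM; apply: acts_byM.
- have -> : k * k' *: (M * M') = (k *: M) * (k' *: M').
    by rewrite -scalerAl -scalerAr scalerA.
  exact: acts_byM.
rewrite sc !rmorphM -mulrA (mulrA (iota s)) E mulrA -rmorphM s'c.
by rewrite rmorphM -mulrA E'.
Qed.

(* (1 + y)^-1 is a geometric sum over the central denominator 1 - (-y)^n. *)
Lemma represents_inv1D y M : acts_by y M -> M * M = 0 -> 1 + y != 0 ->
  (forall q : R, GRing.comm (y ^+ n) q) -> represents (iota (1 + y))^-1 (1 - M).
Proof.
move=> yM M2 y0 yc.
have E : (1 + y) * \sum_(i < n) (- y) ^+ i = 1 - (- y) ^+ n.
  have -> : 1 + y = - (- y - 1) by rewrite opprB opprK.
  by rewrite mulNr -subrX1 opprB.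
have sc q : GRing.comm (1 - (- y) ^+ n) q.
  rewrite exprNn; apply/commr_sym/commrB; first exact: commr1.
  by apply: commrM; [apply/commrX/commrN1 | apply/commr_sym/yc].
have MX i : (- M) ^+ i.+2 = 0 by rewrite exprSr exprSr -mulrA mulrNN M2 mulr0.
exists (1 - (- y) ^+ n), (\sum_(i < n) (- y) ^+ i), 1; split=> //.
- exact: oner_neq0.
- have -> : 1%:M = 1 - (- M) ^+ n :> 'M_2.
    by rewrite -(subnK n_gt1) addn2 MX subr0.
  exact: (acts_byD acts_by1 (acts_byN (acts_byX n (acts_byN yM)))).
- have -> : 1 *: (1 - M) = \sum_(i < n) (- M) ^+ i.
    rewrite scale1r -(subnK n_gt1) addn2 !big_ord_recl.
    by rewrite big1 ?addr0 // => i _; apply: MX.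
  by apply: acts_by_sum => i; apply/acts_byX/acts_byN.
apply: (mulIr (iota_unit y0)); rewrite mulrVK ?iota_unit //.
rewrite -rmorphM -E; congr (iota _).
apply: commr_sum => i _; apply/commrX/commrN.
by apply/commr_sym/commrD => //; apply: commr1.
Qed.

(** * Elements with poles at the place, and the free pair *)

Section Contraction.

Hypothesis sigma_a : sigma a != a.

Let a_neq0 : a != 0.
Proof. by apply: contraNneq sigma_a => ->; rewrite rmorph0. Qed.

Let a_neq1 : 1 - a != 0.
Proof.
by rewrite subr_eq0; apply: contraNneq sigma_a => <-; rewrite rmorph1.
Qed.

(** Take f = (X - sigma a) Q, the product of the X - sigma^j a for 0 < j < d, d the period of a. It
    does not vanish at a, while sigma f = (X - a) Q and sigma^-1 f do. So f(z) and (sigma f)(z) act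
    as multiples of the two coordinate projections. *)
Lemma separating_poly : exists (f : {poly K}) (u : K),
  [/\ u != 0,
   map_poly sigma f * ('X - (sigma a)%:P) = f * ('X - a%:P),
   acts_by (central_eval f) (mx2 u 0 0 0)
   & acts_by (central_eval (map_poly sigma f)) (mx2 0 0 0 u)].
Proof.
have [Q [QE Qa]] := period_poly sigma_a.
have actA := acts_by_central_eval_map ('X - a%:P).
rewrite rmorphB /= map_polyX map_polyC !hornerXsubC subrr /= in actA.
have [c actQ] := acts_by_central_eval Q.
have actU := acts_byM actA actQ.
rewrite mx2_mul !(mulr0, mul0r, addr0) -rmorphM in actU.
have := acts_by_central_eval_map (('X - (sigma a)%:P) * Q).
rewrite {2}QE !hornerM !hornerXsubC subrr mul0r => actV.
exists (('X - (sigma a)%:P) * Q), ((a - sigma a) * Q.[a]); split => //.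
  by rewrite mulf_neq0 // subr_eq0 eq_sym.
by rewrite QE; ring.
Qed.

Lemma hyperbolic_element : exists (p : R) (g : D) (k0 k1 : K),
  [/\ p != 0, forall q, GRing.comm p q, acts_by p 0, g != 0 &
   [/\ k0 != 0, k1 != 0, represents (iota p * g) (mx2 k0 0 0 0)
    & represents (iota p * g^-1) (mx2 0 0 0 k1)]].
Proof.
have [f [u [u0 fE actU actV]]] := separating_poly.
(* [b] is sigma^-1 a, so X - a is the image of X - b under sigma and acts through diag(0, a - b). *)
pose b := iter n.-1 sigma a.
have sb : sigma b = a by rewrite /b -iterS prednK ?sigma_n // ltnW.
have b_neq : a - b != 0.
  rewrite subr_eq0; apply: contra_neq sigma_a => ab.
  by rewrite {1}ab sb.
have actA := acts_by_central_eval_map ('X - b%:P).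
rewrite rmorphB /= map_polyX map_polyC /= sb !hornerXsubC subrr in actA.
have actA' := acts_by_central_eval_map ('X - a%:P).
rewrite rmorphB /= map_polyX map_polyC /= !hornerXsubC subrr in actA'.
have sa0 : a - sigma a != 0 by rewrite subr_eq0 eq_sym.
pose p := central_eval (f * ('X - a%:P)).
pose G := central_eval (f * ('X - (sigma a)%:P)).
pose G' := central_eval (map_poly sigma f * ('X - a%:P)).
have actP : acts_by p 0.
  have := acts_byM actU actA.
  by rewrite -rmorphM mx2_mul !(mulr0, mul0r, addr0) -mx2_0.
have actG : acts_by G (mx2 (u * (a - sigma a)) 0 0 0).
  have := acts_byM actU actA'.
  by rewrite -rmorphM mx2_mul !(mulr0, mul0r, addr0).
have actG' : acts_by G' (mx2 0 0 0 (u * (a - b))).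
  have := acts_byM actV actA.
  by rewrite -rmorphM mx2_mul !(mulr0, mul0r, addr0, add0r).
have p0 : p != 0.
  rewrite /p rmorphM mul_neq0 //.
    by rewrite (acts_by_neq0 _ actU) ?mx2_eq0 ?(negPf u0).
  by rewrite (acts_by_neq0 _ actA) // mx2_eq0 (negPf b_neq) !andbF.
have G0 : G != 0.
  by rewrite (acts_by_neq0 _ actG) // mx2_eq0 mulf_eq0 (negPf u0) (negPf sa0).
have GG' : G * G' = p * p.
  rewrite -!rmorphM -{2}fE; congr central_eval; ring.
(* By [fE], the polynomial f (X - a) is fixed by sigma, so its value at z commutes with t. *)
have pc q : GRing.comm p q.
  apply: skewpoly_centralP q => [|x].
    rewrite /GRing.comm skewpolyX_central_eval; congr (central_eval _ * _).
    rewrite -{1}fE rmorphM rmorphB /= map_polyX map_polyC /= .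
    by rewrite mulrC.
  by rewrite /GRing.comm -central_evalC -!rmorphM mulrC.
(* This is (z - sigma a) / (z - a), as p and G have the common factor f. *)
exists p, ((iota p)^-1 * iota G), (u * (a - sigma a)), (u * (a - b)).
have Up := iota_unit p0; have UG := iota_unit G0.
split=> //.
- by rewrite -divring_unitE unitrMl ?unitrV.
split; rewrite ?mulf_neq0 //.
  by rewrite mulVKr //; apply: represents_iota.
(* Here p g^-1 = p G^-1 p = G^-1 p^2 = G', by [GG']. *)
rewrite invrM ?unitrV // invrK mulrA.
have -> : iota p * (iota G)^-1 = (iota G)^-1 * iota p.
  by apply: commrV; rewrite /GRing.comm -!(rmorphM iota) pc.
rewrite -mulrA -(rmorphM iota) -GG' (rmorphM iota) mulKr //.
exact: represents_iota.
Qed.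

(** c = (1 + y1)(1 + y2) reduces to a lower times an upper transvection. Both y1 and y2 act by
    nilpotent matrices and have central n-th powers, so [represents_inv1D] controls the inverses. *)
Lemma transverse_element : exists (c : D) (u v : K),
  [/\ c != 0, [/\ u != 0, v != 0 & 1 + u * v != 0],
   represents c (mx2 1 v u (1 + u * v))
   & represents c^-1 (mx2 (1 + u * v) (- v) (- u) 1)].
Proof.
have [f [u [u0 fE actU actV]]] := separating_poly.
have mx2_neq0 (w x y : K) : 1 + mx2 0 w x y != 0.
  by rewrite mx2_1 mx2D mx2_eq0 addr0 oner_eq0.
have shear y M w x : acts_by y M -> M = mx2 0 w x 0 -> w * x = 0 ->
    (forall q : R, GRing.comm (y ^+ n) q) ->
    [/\ 1 + y != 0, represents (iota (1 + y)) (1 + M)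
      & represents (iota (1 + y))^-1 (1 - M)].
  move=> yM ME wx yc.
  have y1M := acts_byD acts_by1 yM.
  have yn : 1 + y != 0 by rewrite (acts_by_neq0 a_neq0 y1M) // ME mx2_neq0.
  split=> //; first exact: represents_iota.
  apply: represents_inv1D => //.
  by rewrite ME mx2_mul !(mulr0, mul0r, add0r) (mulrC x) wx addr0 -mx2_0.
pose y1 := t * central_eval f.
have [] := shear y1 _ 0 u (acts_by_XM actU erefl) erefl (mul0r _).
  rewrite /y1 skewpolyX_central_eval -[X in _ * X]expr1.
  apply: (@twisted_power_central _ 1 1 0); last by rewrite muln0.
  by rewrite (acts_by_neq0 a_neq0 actV) // mx2_eq0 (negPf u0) !andbF.
move=> y1n rep1 rep1V.
(* With this l the lower right entry 1 + u * v is 1 - a, which is not 0. *)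
pose l := - (u ^+ 2)^-1.
pose y2 := C l * (t ^+ n.-1 * central_eval (map_poly sigma f)).
have [d actl] := acts_by_central_eval l%:P.
rewrite hornerC central_evalC in actl.
have act2 : acts_by y2 (mx2 0 (- a / u) 0 0).
  have := acts_byM actl (acts_by_Xn1M actV erefl).
  rewrite mx2_mul !(mulr0, mul0r, addr0, add0r).
  suff -> : l * (a * u) = - a / u by [].
  by rewrite /l; field.
have [] := shear y2 _ (- a / u) 0 act2 erefl (mulr0 _).
  (* Moving t^(n-1) across turns sigma f into sigma^n f = f; this is checked after multiplying by t
     on the left. *)
  have -> : y2 = central_eval (l%:P * f) * t ^+ n.-1.
    rewrite rmorphM /= central_evalC -mulrA; congr (_ * _).
    apply: (mul_cancell (skewpolyX_neq0 sigma)).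
    rewrite mulrA -exprS mulrA skewpolyX_central_eval -mulrA -exprS.
    by rewrite prednK ?(ltnW n_gt1) // Xn_central.
  (* The exponents satisfy (n - 1)^2 = n (n - 2) + 1. *)
  apply: (@twisted_power_central _ n.-1 n.-1 n.-2).
    rewrite rmorphM /= central_evalC mul_neq0 //.
      rewrite (acts_by_neq0 a_neq0 actl) // mx2_eq0 /l oppr_eq0 invr_eq0.
      by rewrite expf_eq0 (negPf u0) andbF.
    by rewrite (acts_by_neq0 a_neq0 actU) // mx2_eq0 (negPf u0).
  by case: (n) n_gt1 => [|[|k]] //= _; rewrite mulnS mulSn; ring.
move=> y2n rep2 rep2V.
exists (iota (1 + y1) * iota (1 + y2)), u, (- a / u).
have U1 := iota_unit y1n; have U2 := iota_unit y2n.
have uv : u * (- a / u) = - a by field.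
split.
- by rewrite -divring_unitE unitrMl.
- by rewrite uv a_neq1 u0 mulf_neq0 ?invr_eq0 ?oppr_eq0.
- have := representsM rep1 rep2; rewrite mx2_1 !mx2D mx2_mul.
  by rewrite !(mulr0, mul0r, addr0, add0r, mul1r, mulr1) [_ + 1]addrC.
rewrite invrM //; have := representsM rep2V rep1V.
rewrite mx2_1 !mx2N !mx2D mx2_mul.
rewrite !(mulr0, mul0r, addr0, add0r, mul1r, mulr1, oppr0) mulrNN.
by rewrite [_ * u]mulrC.
Qed.

Definition letter (g h : D) (l : bool * bool) : D :=
  let x := if l.1 then h else g in if l.2 then x^-1 else x.

Definition no_cancel (l l' : bool * bool) : bool :=
  ~~ ((l.1 == l'.1) && (l.2 != l'.2)).

Lemma free_pair : exists g h : D, [/\ g != 0, h != 0 &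
  forall w, sorted no_cancel w -> \prod_(l <- w) letter g h l = 1 -> w = [::]].
Proof.
have [p [g [k0 [k1 [p0 pc pa g0 [k0n k1n rg rgV]]]]]] := hyperbolic_element.
have [c [u [v [c0 [u0 v0 uv] rc rcV]]]] := transverse_element.
have Ug : g \is a GRing.unit by rewrite divring_unitE.
have Uc : c \is a GRing.unit by rewrite divring_unitE.
(* p stays central in [D], whose elements are all fractions of elements of K[t; sigma]. *)
have pD d : iota p * d = d * iota p.
  have [q [r [q0 ->]]] := D_quot d; apply: commrM.
    by apply: commrV; rewrite /GRing.comm -!rmorphM pc.
  by rewrite /GRing.comm -!rmorphM pc.
have pX m d : iota p ^+ m * d = d * iota p ^+ m.
  by apply/commr_sym/commrX/commr_sym/pD.
exists g, (c * g * c^-1); split=> //.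
  by rewrite -divring_unitE !unitrMl ?unitrV.
move=> [//|l w] wok wE; exfalso.
pose N1 := mx2 1 v u (1 + u * v); pose N2 := mx2 (1 + u * v) (- v) (- u) 1.
have N21 : N2 *m N1 = 1%:M.
  rewrite -[LHS]/(N2 * N1) mx2_mul mx2_scalar.
  by congr mx2; ring.
pose E (b : bool) : 'I_2 := if b then 1 else 0.
pose k (b : bool) := if b then k1 else k0.
have kn b : k b != 0 by case: b.
(* x_l y_l is the leading coefficient of the letter l: a multiple of a coordinate projection,
   conjugated by the reduction [N1] of c for the letters of h. *)
pose x (l : bool * bool) : 'cV[K]_2 :=
  (if l.1 then N1 else 1%:M) *m delta_mx (E l.2) 0.
pose y (l : bool * bool) : 'rV[K]_2 :=
  k l.2 *: (delta_mx 0 (E l.2) *m (if l.1 then N2 else 1%:M)).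
have kE b : mx2 (if b then 0 else k0) 0 0 (if b then k1 else 0) =
    k b *: delta_mx (E b) (E b).
  apply/matrixP=> i j; rewrite !mxE /k /E.
  by case: b; case: i => [[|[|?]] ?] //; case: j => [[|[|?]] ?] //=;
    rewrite ?mulr0 ?mulr1.
pose L := letter g (c * g * c^-1).
have L_rep l' : represents (iota p * L l') (x l' *m y l').
  have xy : x l' *m y l' = (if l'.1 then N1 else 1%:M) *m
      (k l'.2 *: delta_mx (E l'.2) (E l'.2)) *m (if l'.1 then N2 else 1%:M).
    rewrite /x /y -!scalemxAr -scalemxAl !mulmxA.
    by rewrite -(mulmxA _ (delta_mx _ 0)) mul_delta_mx.
  rewrite xy -kE -[_ *m _ *m _]/(_ * _ * _) /L /letter.
  case: l' {xy} => [[] e] /=; last first.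
    by rewrite !mul1r !mulr1; case: e.
  have -> : (if e then (c * g * c^-1)^-1 else c * g * c^-1) =
      c * (if e then g^-1 else g) * c^-1.
    by case: e; rewrite // !invrM ?invrK ?mulrA ?unitrMl ?unitrV.
  rewrite 2!mulrA pD -(mulrA c (iota p)).
  by do 2!apply: representsM => //; case: e.
have prod_rep w' : represents (iota p ^+ size w' * \prod_(l' <- w') L l')
    (\prod_(l' <- w') (x l' *m y l')).
  elim: w' => [|l' w' IH] /=.
    rewrite !big_nil mulr1 expr0 -(rmorph1 iota).
    exact/represents_iota/acts_by1.
  rewrite !big_cons exprS -mulrA (mulrA (iota p ^+ _)) pX -mulrA mulrA.
  exact: representsM.
have := prod_rep (l :: w); rewrite wE mulr1 -rmorphXn.
move=> [s [r [k' [k'0 sc sk rM E']]]].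
(* With the word equal to 1, r = s p^m for m the word length. So r acts by 0, and also by k' times
   the product. *)
have : \prod_(l' <- l :: w) (x l' *m y l') = 0.
  have s0 := acts_byM sk (acts_byX (size w).+1 pa).
  move: E'; rewrite -rmorphM => /iota_inj E'; rewrite E' in s0.
  have := acts_by_inj a_neq0 rM s0; rewrite exprS mul0r mulr0 => /eqP.
  by rewrite scaler_eq0 (negPf k'0) => /eqP.
apply/eqP; apply: (@rank_one_prod _ _ _ no_cancel).
- by move=> [b e]; rewrite /no_cancel /= !eqxx.
- move=> i j ij.
  rewrite /y -scalemxAl scaler_eq0 negb_or kn /= /x -mulmxA.
  rewrite (mulmxA (if _ then _ else _)).
  set N := _ *m (if j.1 then _ else _).
  (* For letters of the same generator [N] is the identity, and i, j not being inverse selects a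
     diagonal entry. For different generators [N] is [N1] or [N2], which have no zero entry. *)
  have Nij : N (E i.2) (E j.2) != 0.
    rewrite /N; case: i j ij {N} => [[] e] [[] e'] /=;
      rewrite /no_cancel /= ?mul1mx ?mulmx1 ?N21.
    + by move/negbNE/eqP->; rewrite mxE eqxx oner_neq0.
    + by move=> _; case: e; case: e'; rewrite !mxE /= ?oppr_eq0 ?oner_neq0.
    + by move=> _; case: e; case: e'; rewrite !mxE /= ?oppr_eq0 ?oner_neq0.
    + by move/negbNE/eqP->; rewrite mxE eqxx oner_neq0.
  apply: contraNneq Nij => /matrixP/(_ 0 0).
  by rewrite mulmxA -mulmxA -/N -rowE -colE !mxE => ->.
exact: wok.
Qed.
End Contraction.

End LocalAction.

(** * From a free pair to a free non-cyclic subgroup *)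

Section FreePairs.
Variable G : groupType.
Local Open Scope group_scope.
Implicit Types (g h x y : G) (w : seq (G * bool)).

Lemma word_val_cat w1 w2 : word_val (w1 ++ w2) = word_val w1 * word_val w2.
Proof. by rewrite /word_val big_cat. Qed.

Lemma word_val_inv w :
  word_val (rev [seq (l.1, ~~ l.2) | l <- w]) = (word_val w)^-1.
Proof.
elim: w => [|[x b] w IH]; first by rewrite /word_val big_nil invg1.
rewrite /= rev_cons -cats1 word_val_cat IH /word_val big_seq1 big_cons invgM.
by case: b; rewrite /= ?invgK.
Qed.

Lemma span_subgroup (X : G -> Prop) :
  subgroup (fun x => exists2 w, word_over X w & word_val w = x).
Proof.
split; first by exists [::]; rewrite // /word_val big_nil.
move=> _ _ [v Xv <-] [w Xw <-].
exists (v ++ rev [seq (l.1, ~~ l.2) | l <- w]); last first.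
  by rewrite word_val_cat word_val_inv.
move=> l; rewrite mem_cat mem_rev => /orP[/Xv //|/mapP[m /Xw Xm ->]]; exact: Xm.
Qed.

Lemma cyclic_subgroup_commute (H : G -> Prop) x y :
  cyclic_subgroup H -> H x -> H y -> commute x y.
Proof.
move=> [z Hz] /Hz[m xE] /Hz[k yE].
have zz i j : commute (z ^+ i) (z ^+ j).
  exact/commuteX/commute_sym/commuteX/commute_refl.
case: xE => ->; case: yE => ->; try exact: zz.
- exact/commuteV/zz.
- exact/commute_sym/commuteV/zz.
- exact/commuteV/commute_sym/commuteV/zz.
Qed.

Definition pair_letter g h (l : bool * bool) : G :=
  let x := if l.1 then h else g in if l.2 then x^-1 else x.

Lemma free_pair_noncyclic_subgroup g h :
    (forall w : seq (bool * bool), sorted no_cancel w ->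
       \prod_(l <- w) pair_letter g h l = 1 ->
       w = [::]) ->
  exists H : G -> Prop, [/\ subgroup H, free_subgroup H & ~ cyclic_subgroup H].
Proof.
move=> free_gh; pose X x := x = g \/ x = h.
(* Otherwise the reduced word g h^-1 would have value 1. *)
have gh : g != h.
  apply/eqP=> gh; have := free_gh [:: (false, false); (true, true)] isT.
  by rewrite big_cons big_seq1 /pair_letter /= gh mulgV => /(_ erefl).
exists (fun x => exists2 w, word_over X w & word_val w = x); split.
- exact: span_subgroup.
- exists X; split=> // w Xw wr w1.
  (* As g and h differ, [enc] is injective on letters over {g, h}, so it keeps words reduced. *)
  pose enc (l : G * bool) := (l.1 == h, l.2).
  suff: [seq enc l | l <- w] = [::] by case: (w).
  apply: free_gh.
    rewrite sorted_map; move: wr.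
    apply: (@sub_in_sorted _ [pred l | (l.1 == g) || (l.1 == h)]).
      move=> [x b] [y b']; rewrite !inE /= /no_cancel /= => Xx Xy.
      apply: contraNN => /andP[/eqP xy ->]; rewrite andbT.
      case/orP: Xx Xy xy => /eqP-> /orP[] /eqP-> //;
        by rewrite !eqxx ?(negPf gh).
    by apply/allP=> l /Xw [] /= ->; rewrite eqxx ?orbT.
  rewrite big_map -[RHS]w1 /word_val; apply: eq_big_seq => l /Xw.
  by rewrite /pair_letter /enc /=; case=> ->; rewrite ?eqxx ?(negPf gh).
move=> cycH; have cgh := cyclic_subgroup_commute (x := g) (y := h) cycH.
have Hx x : X x -> exists2 w, word_over X w & word_val w = x.
  move=> Xx; exists [:: (x, false)]; last by rewrite /word_val big_seq1.
  by move=> l; rewrite inE => /eqP->.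
have {}cgh : commute g h by apply: cgh; apply: Hx; [left | right].
(* The commutator g h g^-1 h^-1 is a nonempty reduced word, but has value 1 if g and h commute. *)
have := free_gh [:: (false, false); (true, false); (false, true);
  (true, true)] isT.
rewrite !big_cons big_nil /pair_letter /= mulg1 (mulgA g) cgh.
by rewrite -mulgA (mulgA g) mulgV mul1g mulgV => /(_ erefl).
Qed.

End FreePairs.

(** * The case sigma = id, and the conclusion in the multiplicative group *)

Lemma skewpoly_comm (K : fieldType) (sigma : {rmorphism K -> K}) :
  sigma =1 id -> commutative (@GRing.mul (skewpoly sigma)).
Proof.
move=> sid p q.
have XC a : GRing.comm (skewpolyX sigma) (skewpolyC sigma a).
  by rewrite /GRing.comm skewpolyXC sid.
have CX a : GRing.comm (skewpolyC sigma a) (skewpolyX sigma).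
  exact/commr_sym/XC.
apply: skewpoly_centralP => [|a]; apply/commr_sym/skewpoly_centralP => // b.
by rewrite /GRing.comm -!rmorphM mulrC.
Qed.

Theorem mainTheorem7 (K : fieldType) (sigma : {rmorphism K -> K})
    (sigma_aut : bijective sigma) (sigma_fin : finite_order sigma)
    (D : divRingType) (iota : {rmorphism skewpoly sigma -> D})
    (D_quot : quotient_division_ring iota)
    (D_notfield : ~ commutative (fun x y : D => x * y)) :
  exists H : mulgrp D -> Prop,
    [/\ subgroup H, free_subgroup H & ~ cyclic_subgroup H].
Proof.
have [iota_inj quot] := D_quot; have [n n0 sigma_n] := sigma_fin.
(* If sigma fixed all of K, then K[t; sigma] would be commutative, and so would its fractions. *)
have [a sa] : exists a, sigma a != a.
  apply: NNPP => none; apply: D_notfield => x y.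
  have sid : sigma =1 id.
    by move=> a; apply/eqP; apply: contra_notT none => sa; exists a.
  have cc p q : GRing.comm (iota p) (iota q).
    by rewrite /GRing.comm -!rmorphM skewpoly_comm.
  have cx p : GRing.comm (iota p) x.
    by have [q [r [_ ->]]] := quot x; apply: commrM => //; apply: commrV.
  have [q [r [_ ->]]] := quot y.
  by apply: commrM; [apply: commrV|]; apply/commr_sym/cx.
have n1 : (1 < n)%N.
  case: n n0 sigma_n => [|[|]] // _ s1.
  by rewrite -[sigma a]/(iter 1 sigma a) s1 eqxx in sa.
have [g [h [g0 h0 free_gh]]] := free_pair n1 sigma_n iota_inj quot sa.
pose g' : mulgrp D := Sub g g0; pose h' : mulgrp D := Sub h h0.
apply: (@free_pair_noncyclic_subgroup _ g' h') => w wr w1.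
apply: free_gh => //; have := congr1 val w1.
rewrite (big_morph val (fun _ _ => erefl) erefl) /= => w1'.
by rewrite -[RHS]w1'; apply: eq_bigr => -[[] []].
Qed.
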